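(* Let $\mathbf{p}_{e_1}\neq\mathbf{p}_{e_2}$ be two distinct points (the 1D points) in the plane of a grid face $f$, and let $l_1$ and $l_2$ be lines in this plane passing through $\mathbf{p}_{e_1}$ and $\mathbf{p}_{e_2}$, respectively. Assume that $l_1$ and $l_2$ are either identical, or meet at a unique point $\mathbf{u}$ which is neither $\mathbf{p}_{e_1}$ nor $\mathbf{p}_{e_2}$. Assume that the inside/outside boundary in the plane is the one determined by $l_1$ and $l_2$ (the local flatness model described in the context). Let $\mathbf{m}$ be the midpoint of $\mathbf{p}_{e_1}$ and $\mathbf{p}_{e_2}$. Then the point $\mathbf{p}_f$ returned by the 2D point search procedure (described in the context) is well defined and satisfies: $\mathbf{p}_f=\mathbf{m}$ if $l_1=l_2$, and $\mathbf{p}_f=\mathbf{u}$ if $l_1$ and $l_2$ meet at the unique point $\mathbf{u}$.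
   Context: All objects lie in a Euclidean plane (the plane extending a square grid face $f$). Every point of the plane carries a label, inside or outside (a binary occupancy function). Points $\mathbf{p}_{e_1}\neq \mathbf{p}_{e_2}$ are ''1D points'', i.e. points of two edges of $f$ at which the label changes. Write $l$ for the line through $\mathbf{p}_{e_1}$ and $\mathbf{p}_{e_2}$, and $\mathbf{m}=\tfrac12(\mathbf{p}_{e_1}+\mathbf{p}_{e_2})$. Local flatness model determined by lines $l_1\ni\mathbf{p}_{e_1}$, $l_2\ni\mathbf{p}_{e_2}$. Let $C$ denote the closed set whose interior points have one label and whose complement has the other label, as follows; $C$ contains $\mathbf{m}$, and the label of $C$ is called the label of $\mathbf{m}$. (A) If $l_1=l_2$ (hence both equal $l$), then $C$ is a closed half-plane bounded by $l$. (B) If $l_1$ and $l_2$ meet at a unique point $\mathbf{u}\notin\{\mathbf{p}_{e_1},\mathbf{p}_{e_2}\}$, then the boundary near the face passes from $\mathbf{p}_{e_1}$ straight to $\mathbf{u}$ and then straight to $\mathbf{p}_{e_2}$, and $C=\{\mathbf{u}+a(\mathbf{p}_{e_1}-\mathbf{u})+b(\mathbf{p}_{e_2}-\mathbf{u}) : a,b\ge 0\}$. For a point $\mathbf{x}\in C$ and a direction $\mathbf{d}\neq 0$, the closest surface-crossing point along the ray from $\mathbf{x}$ in direction $\mathbf{d}$ is $\mathbf{x}+t^*\mathbf{d}$, where $t^*=\sup\{t\ge 0 : \mathbf{x}+s\mathbf{d}\in C \text{ for all } 0\le s\le t\}$ (the place where the label first changes away from the label of $\mathbf{m}$; $t^*=0$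 is allowed). 2D point search procedure, with output $\mathbf{p}_f$: (1) Let $r$ be the ray from $\mathbf{m}$ orthogonal to $l$, directed towards the side of $l$ where a grid vertex has a label different from the label of $\mathbf{m}$. In the local flatness model this is the side of $l$ not contained in $C$ in case (A), and the side of $l$ containing $\mathbf{u}$ in case (B). Let $\mathbf{q}$ be the closest surface-crossing point along $r$. If $\mathbf{q}=\mathbf{m}$, set $\mathbf{p}_f=\mathbf{m}$ and stop. (2) Otherwise, from $\mathbf{q}$ shoot the two rays parallel to $l$: $r_1$ in direction $\mathbf{p}_{e_1}-\mathbf{m}$ and $r_2$ in direction $\mathbf{p}_{e_2}-\mathbf{m}$. Let $\mathbf{q}_1$ and $\mathbf{q}_2$ be the closest surface-crossing points along $r_1$ and $r_2$, respectively. (3) Let $\mathbf{p}_f$ be the intersection point of the line through $\mathbf{p}_{e_1}$ and $\mathbf{q}_1$ with the line through $\mathbf{p}_{e_2}$ and $\mathbf{q}_2$. *)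

(* Defs.v *)
(* Library: MathComp and MathComp-Analysis. *)
From HB Require Import structures.
From mathcomp Require Import all_boot all_order all_algebra.
From mathcomp Require Import all_classical all_reals all_analysis.

Set Implicit Arguments.
Unset Strict Implicit.
Unset Printing Implicit Defensive.

Import Order.TTheory GRing.Theory Num.Theory.
Import numFieldNormedType.Exports.
Local Open Scope classical_set_scope.
Local Open Scope ring_scope.

(* The Euclidean plane is 'rV[R]_2 with the inner product [dot]; the library
   topology on 'rV[R]_2 (sup norm) is the Euclidean one. *)

Definition dot (R : realType) (x y : 'rV[R]_2) : R :=
  \sum_(i < 2) x 0 i * y 0 i.

Definition midpoint (R : realType) (a b : 'rV[R]_2) : 'rV[R]_2 :=
  2^-1 *: (a + b).

Definition is_line (R : realType) (l : set 'rV[R]_2) : Prop :=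
  exists a d : 'rV[R]_2, d != 0 /\ l = [set a + t *: d | t in [set: R]].

(* A line only when a != b. *)
Definition line_through (R : realType) (a b : 'rV[R]_2) : set 'rV[R]_2 :=
  [set a + t *: (b - a) | t in [set: R]].

Definition closed_halfplane (R : realType) (l C : set 'rV[R]_2) : Prop :=
  exists (n : 'rV[R]_2) (c : R),
    [/\ n != 0, l = [set x | dot n x = c] & C = [set x | dot n x <= c]].

(* H is one of the two sides of l. *)
Definition open_side (R : realType) (l H : set 'rV[R]_2) : Prop :=
  exists (n : 'rV[R]_2) (c : R),
    [/\ n != 0, l = [set x | dot n x = c] & H = [set x | dot n x < c]].

Definition cone (R : realType) (u a b : 'rV[R]_2) : set 'rV[R]_2 :=
  [set x | exists s t : R,
     [/\ 0 <= s, 0 <= t & x = u + s *: (a - u) + t *: (b - u)]].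

(* [occ x = true] means that x is inside.  [lab] is the label of C, which is by
   convention the label of the midpoint; the labels of the points on the
   boundary of C are left unspecified. *)
Definition local_flatness (R : realType) (p1 p2 : 'rV[R]_2)
    (l1 l2 C : set 'rV[R]_2) (occ : 'rV[R]_2 -> bool) (lab : bool) : Prop :=
  [/\ forall x, interior C x -> occ x = lab,
      forall x, ~ C x -> occ x = ~~ lab,
      l1 = l2 -> closed_halfplane (line_through p1 p2) C
    & forall u, l1 `&` l2 = [set u] -> C = cone u p1 p2].

(* q is the closest surface-crossing point along the ray from x in direction d.
   [has_sup] rules out rays that never leave C. *)
Definition crossing (R : realType) (C : set 'rV[R]_2) (x d q : 'rV[R]_2) :
    Prop :=
  let S : set R :=
    [set t | 0 <= t /\ forall s, 0 <= s <= t -> C (x + s *: d)] in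
  [/\ C x, d != 0, has_sup S & q = x + sup S *: d].

Definition first_ray (R : realType) (p1 p2 : 'rV[R]_2)
    (l1 l2 C : set 'rV[R]_2) (d : 'rV[R]_2) : Prop :=
  [/\ d != 0, dot d (p2 - p1) = 0
    & exists H : set 'rV[R]_2,
        [/\ open_side (line_through p1 p2) H,
            l1 = l2 -> ~ H `<=` C,
            forall u, l1 `&` l2 = [set u] -> H u
          & forall t, 0 < t -> H (midpoint p1 p2 + t *: d)]].

(* The search as an input/output relation.  The direction d of the first ray is
   determined up to a positive factor, which does not affect q. *)
Definition point_search (R : realType) (p1 p2 : 'rV[R]_2)
    (l1 l2 C : set 'rV[R]_2) (pf : 'rV[R]_2) : Prop :=
  let m := midpoint p1 p2 in
  exists d q : 'rV[R]_2,
    [/\ first_ray p1 p2 l1 l2 C d,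
        crossing C m d q,
        q = m -> pf = m
      & q <> m -> exists q1 q2 : 'rV[R]_2,
          [/\ crossing C q (p1 - m) q1,
              crossing C q (p2 - m) q2,
              p1 != q1,
              p2 != q2
            & line_through p1 q1 `&` line_through p2 q2 = [set pf]]].

(* Main.v *)
Require Import Defs.
From HB Require Import structures.
From mathcomp Require Import all_boot all_order all_algebra.
From mathcomp Require Import all_classical all_reals all_analysis.
From mathcomp Require Import ring lra.

Set Implicit Arguments.
Unset Strict Implicit.
Unset Printing Implicit Defensive.

Import Order.TTheory GRing.Theory Num.Theory.
Import numFieldNormedType.Exports.
Local Open Scope classical_set_scope.
Local Open Scope ring_scope.

(* When l1 = l2, the first ray leaves the half-plane C immediately at the
   midpoint.  Otherwise p1 - u and p2 - u form a basis in which C is the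
   nonnegative quadrant with origin u, and the line l is s + t = 1.  The first
   ray strictly decreases s + t and stops at some q = (s, t) other than the
   midpoint; moving parallel to l preserves s + t, so q1 = (s + t, 0) and
   q2 = (0, s + t).  As s + t < 1, these differ from p1 = (1, 0) and
   p2 = (0, 1), so the last two lines are l1 and l2, which meet at u.  This
   includes the case q = u, where q1 = q2 = u. *)

(** * Coordinates and inner product *)

Lemma row2P (R : realType) (x y : 'rV[R]_2) :
  x 0 0 = y 0 0 -> x 0 1 = y 0 1 -> x = y.
Proof.
move=> h0 h1; apply/rowP => i; case: (unliftP 0 i) => [j ->|->] //.
by rewrite (ord1 j) (_ : lift 0 0 = 1) //; apply/val_inj.
Qed.

Lemma dotE (R : realType) (x y : 'rV[R]_2) :
  dot x y = x 0 0 * y 0 0 + x 0 1 * y 0 1.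
Proof.
rewrite /dot !big_ord_recl big_ord0 addr0.
by rewrite (_ : lift 0 0 = 1) //; apply/val_inj.
Qed.

Lemma dotDr (R : realType) (n x y : 'rV[R]_2) :
  dot n (x + y) = dot n x + dot n y.
Proof. rewrite !dotE !mxE; ring. Qed.

Lemma dotZr (R : realType) (n x : 'rV[R]_2) (t : R) :
  dot n (t *: x) = t * dot n x.
Proof. rewrite !dotE !mxE; ring. Qed.

Lemma dotDZr (R : realType) (n x y : 'rV[R]_2) (t : R) :
  dot n (x + t *: y) = dot n x + t * dot n y.
Proof. by rewrite dotDr dotZr. Qed.

Lemma dotBr (R : realType) (n x y : 'rV[R]_2) :
  dot n (x - y) = dot n x - dot n y.
Proof. rewrite !dotE !mxE; ring. Qed.

Lemma dotZl (R : realType) (n x : 'rV[R]_2) (t : R) :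
  dot (t *: n) x = t * dot n x.
Proof. rewrite !dotE !mxE; ring. Qed.

Lemma dotNl (R : realType) (n x : 'rV[R]_2) : dot (- n) x = - dot n x.
Proof. rewrite !dotE !mxE; ring. Qed.

Lemma dot_gt0 (R : realType) (x : 'rV[R]_2) : x != 0 -> 0 < dot x x.
Proof.
move=> x0; rewrite lt_neqAle dotE addr_ge0 ?andbT -?expr2 ?sqr_ge0 //.
apply: contra x0; rewrite eq_sym paddr_eq0 ?sqr_ge0 // !sqrf_eq0.
by case/andP=> /eqP h0 /eqP h1; apply/eqP; apply: row2P; rewrite mxE.
Qed.

(** * Determinants and linear independence *)

Definition perp (R : realType) (v : 'rV[R]_2) : 'rV[R]_2 :=
  \row_i (if i == 0 then - v 0 1 else v 0 0).

(** This is the determinant of the pair [v], [w]; below, [dot (perp a) b != 0] expresses linear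
    independence. *)
Lemma dot_perp (R : realType) (v w : 'rV[R]_2) :
  dot (perp v) w = v 0 0 * w 0 1 - v 0 1 * w 0 0.
Proof. rewrite dotE !mxE /=; ring. Qed.

Lemma dot_perpxx (R : realType) (v : 'rV[R]_2) : dot (perp v) v = 0.
Proof. rewrite dot_perp; ring. Qed.

Lemma dot_perpC (R : realType) (v w : 'rV[R]_2) :
  dot (perp v) w = - dot (perp w) v.
Proof. rewrite !dot_perp; ring. Qed.

Lemma perp_neq0 (R : realType) (v w : 'rV[R]_2) :
  dot (perp v) w != 0 -> perp v != 0.
Proof.
apply: contraNneq => ->; rewrite dotE !mxE; apply/eqP; ring.
Qed.

Lemma basis_decomposition (R : realType) (a b v : 'rV[R]_2) :
  dot (perp a) b != 0 ->
  exists s t : R, v = s *: a + t *: b.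
Proof.
(* Cramer's rule. *)
move=> D; exists (dot (perp v) b / dot (perp a) b).
exists (dot (perp a) v / dot (perp a) b).
rewrite !dot_perp in D *.
by apply: row2P; rewrite !mxE; field.
Qed.

(** Pairing with [perp a] kills the [a] term and isolates the coefficient of [b], and vice versa. *)
Lemma comb_inj (R : realType) (a b : 'rV[R]_2) (s t s' t' : R) :
  dot (perp a) b != 0 -> s *: a + t *: b = s' *: a + t' *: b ->
  s = s' /\ t = t'.
Proof.
move=> D e.
have Dba : dot (perp b) a != 0 by rewrite dot_perpC oppr_eq0.
have ea := congr1 (dot (perp a)) e; have eb := congr1 (dot (perp b)) e.
move: ea eb; rewrite !dotDr !dotZr !dot_perpxx !mulr0 !add0r !addr0.
by move=> /(mulIf D) -> /(mulIf Dba) ->.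
Qed.

Lemma orthogonal_parallel (R : realType) (n v w : 'rV[R]_2) :
  n != 0 -> dot n v = 0 -> dot n w = 0 -> w != 0 -> exists t : R, v = t *: w.
Proof.
(* The coefficient of the orthogonal projection of [v] on [w]. *)
move=> n0 nv nw w0; exists (dot v w / dot w w).
have ww := lt0r_neq0 (dot_gt0 w0).
have nn := lt0r_neq0 (dot_gt0 n0).
have e : dot (perp w) v = 0.
  apply: (mulfI nn); rewrite mulr0.
  have -> : dot n n * dot (perp w) v =
    dot (perp n) v * dot n w - dot (perp n) w * dot n v.
    by rewrite !dot_perp !dotE; ring.
  by rewrite nv nw; ring.
(* Coordinatewise, [dot w w *: v] is [dot v w *: w] plus the determinant times [perp w]; by [e] the
   second term vanishes. *)
rewrite dot_perp in e; rewrite !dotE in ww *.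
apply: row2P; rewrite !mxE; apply: (mulfI ww);
  rewrite mulrA [_ * (_ / _)]mulrC divfK //.
  transitivity ((v 0 0 * w 0 0 + v 0 1 * w 0 1) * w 0 0
     - w 0 1 * (w 0 0 * v 0 1 - w 0 1 * v 0 0)); first by ring.
  by rewrite e; ring.
transitivity ((v 0 0 * w 0 0 + v 0 1 * w 0 1) * w 0 1
   + w 0 0 * (w 0 0 * v 0 1 - w 0 1 * v 0 0)); first by ring.
by rewrite e; ring.
Qed.

(** * Lines *)

Lemma line_throughE (R : realType) (a b n : 'rV[R]_2) :
  a != b -> n != 0 -> dot n (b - a) = 0 ->
  line_through a b = [set x | dot n x = dot n a].
Proof.
move=> ab n0 nab; apply/seteqP; split => [_ [t _ <-]|x /= e].
  by rewrite /= dotDZr nab mulr0 addr0.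
have nxa : dot n (x - a) = 0 by rewrite dotBr e subrr.
have ba0 : b - a != 0 by rewrite subr_eq0 eq_sym.
have [t et] := orthogonal_parallel n0 nxa nab ba0.
by exists t => //; rewrite -et addrC subrK.
Qed.

Lemma line_through_l (R : realType) (a b : 'rV[R]_2) : line_through a b a.
Proof. by exists 0 => //; rewrite scale0r addr0. Qed.

Lemma line_through_r (R : realType) (a b : 'rV[R]_2) : line_through a b b.
Proof. by exists 1 => //; rewrite scale1r addrC subrK. Qed.

Lemma is_line_through (R : realType) (l : set 'rV[R]_2) (a b : 'rV[R]_2) :
  is_line l -> l a -> l b -> a != b -> l = line_through a b.
Proof.
move=> [c [d [d0 ->]]] [s _ <-] [t _ <-] ab.
have st : t - s != 0.
  by apply: contraNneq ab => /eqP; rewrite subr_eq0 => /eqP ->.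
apply/seteqP; split => [_ [r _ <-]|_ [r _ <-]].
  exists ((r - s) / (t - s)) => //.
  by apply: row2P; rewrite !mxE; field.
exists (s + r * (t - s)) => //.
by apply: row2P; rewrite !mxE; ring.
Qed.

Lemma midpointC (R : realType) (a b : 'rV[R]_2) : midpoint a b = midpoint b a.
Proof. by rewrite /midpoint addrC. Qed.

Lemma line_through_midpoint (R : realType) (a b : 'rV[R]_2) :
  line_through a b (midpoint a b).
Proof. by exists 2^-1 => //; apply: row2P; rewrite !mxE; field. Qed.

(** * Closest crossing points of rays *)

Lemma crossingP (R : realType) (C : set 'rV[R]_2) (x d q : 'rV[R]_2) (T : R) :
  d != 0 -> 0 <= T -> (forall s, 0 <= s -> C (x + s *: d) <-> s <= T) ->
  crossing C x d q <-> q = x + T *: d.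
Proof.
move=> d0 T0 CT.
have Cx : C x by have := (CT 0 (lexx _)).2 T0; rewrite scale0r addr0.
rewrite /crossing; set S := [set t | _].
(* The ray meets [C] exactly for parameters in [[0, T]], so the supremum exists and is [T]; [T = 0]
   covers a ray leaving at once. *)
have -> : S = `[0, T]%classic.
  apply/seteqP; split => t /=; rewrite in_itv /=.
    by case=> t0 /(_ t) h; rewrite t0; apply/(CT t t0)/h; rewrite t0 lexx.
  case/andP=> t0 tT; split=> // s /andP[s0 st].
  by apply/(CT s s0)/(le_trans st).
rewrite sup_itv //; split => [[]//|->]; split => //.
Qed.

Lemma coneC (R : realType) (u a b : 'rV[R]_2) : cone u a b = cone u b a.
Proof.
by apply/seteqP; split => x [s [t [s0 t0 ->]]]; exists t, s; split=> //;
  rewrite addrAC.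
Qed.

Lemma cone_comb (R : realType) (u a b : 'rV[R]_2) (s t : R) :
  dot (perp (a - u)) (b - u) != 0 ->
  cone u a b (u + s *: (a - u) + t *: (b - u)) <-> 0 <= s /\ 0 <= t.
Proof.
move=> D; split => [[s' [t' [s0 t0]]]|[s0 t0]]; last by exists s, t.
by rewrite -!addrA => /addrI /(comb_inj D)[-> ->].
Qed.

(** The direction is half of [(p1 - u) - (p2 - u)]: the first coordinate grows and the second falls,
    both at rate 1/2. The ray leaves the cone when the second reaches 0, at parameter [2 * t]. *)
Lemma crossing_cone_parallel (R : realType) (u p1 p2 q : 'rV[R]_2) (s t : R) :
  dot (perp (p1 - u)) (p2 - u) != 0 -> p1 != p2 -> 0 <= s -> 0 <= t ->
  crossing (cone u p1 p2) (u + s *: (p1 - u) + t *: (p2 - u))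
    (p1 - midpoint p1 p2) q <-> q = u + (s + t) *: (p1 - u).
Proof.
move=> D p12 s0 t0.
rewrite (@crossingP _ _ _ _ _ (2 * t)).
- by rewrite (_ : u + _ + _ + _ = u + (s + t) *: (p1 - u)) //;
    apply: row2P; rewrite !mxE; field.
- apply: contra_neq p12 => /subr0_eq e.
  have : 2 *: (p1 - midpoint p1 p2) = p1 - p2.
    by apply: row2P; rewrite !mxE; field.
  by rewrite -e subrr scaler0 => /esym/subr0_eq.
- by rewrite mulr_ge0.
move=> r r0.
rewrite (_ : _ + r *: _ =
    u + (s + r / 2) *: (p1 - u) + (t - r / 2) *: (p2 - u)); last first.
  by apply: row2P; rewrite !mxE; field.
rewrite cone_comb //; split => [[_]|h]; first by lra.
by split; lra.
Qed.

(** The midpoint has coordinates (1/2, 1/2). As [al + be < 0], some coordinate decreases; the one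
    falling fastest, at rate [M], reaches 0 first, at time [T = 1 / (2 M)]. There the coordinate sum
    is [1 + T * (al + be)]. *)
Lemma crossing_cone_midpoint (R : realType) (u p1 p2 d : 'rV[R]_2) (al be : R) :
  dot (perp (p1 - u)) (p2 - u) != 0 ->
  d = al *: (p1 - u) + be *: (p2 - u) -> al + be < 0 ->
  exists s t : R, [/\ 0 <= s, 0 <= t, s + t < 1 &
    forall q, crossing (cone u p1 p2) (midpoint p1 p2) d q <->
      q = u + s *: (p1 - u) + t *: (p2 - u)].
Proof.
move=> D dE ab.
have d0 : d != 0.
  apply: contraTneq ab => d0; move: dE; rewrite d0 => /esym e.
  have [|-> ->] := @comb_inj _ _ _ al be 0 0 D; last by rewrite addr0 ltxx.
  by rewrite e !scale0r addr0.
have mE r : midpoint p1 p2 + r *: d =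
    u + (2^-1 + r * al) *: (p1 - u) + (2^-1 + r * be) *: (p2 - u).
  by rewrite dE; apply: row2P; rewrite !mxE; field.
clear dE.
pose M := Num.max (- al) (- be).
have M0 : 0 < M.
  by rewrite lt_max; apply/orP; case: (ltP 0 (- al)) => h; [left|right; lra].
have aM : - al <= M by rewrite le_max lexx.
have bM : - be <= M by rewrite le_max lexx orbT.
pose T := 2^-1 / M.
have T0 : 0 < T by rewrite divr_gt0 // invr_gt0.
have TM : T * M = 2^-1 by rewrite divfK // gt_eqF.
have CT r : 0 <= r -> cone u p1 p2 (midpoint p1 p2 + r *: d) <-> r <= T.
  move=> r0; rewrite mE cone_comb // -[r <= T](ler_pM2r M0) TM; split.
    by rewrite /M; case: (leP (- al) (- be)) => _ [? ?]; lra.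
  by move=> h; split; nra.
have [s0 t0] : 0 <= 2^-1 + T * al /\ 0 <= 2^-1 + T * be.
  by rewrite -(cone_comb _ _ D) -mE; apply/CT => //; exact: ltW.
exists (2^-1 + T * al), (2^-1 + T * be); split => //.
  by have : T * (al + be) < 0; [rewrite pmulr_rlt0 | lra].
by move=> q; rewrite -mE; apply: crossingP => //; exact: ltW.
Qed.

(** * Relative position of the two lines *)

Lemma noncollinear (R : realType) (p1 p2 u : 'rV[R]_2) (l1 l2 : set 'rV[R]_2) :
  is_line l1 -> is_line l2 -> l1 p1 -> l2 p2 -> l1 `&` l2 = [set u] ->
  u != p1 -> u != p2 -> dot (perp (p1 - u)) (p2 - u) != 0.
Proof.
move=> L1 L2 l1p l2p lu up1 up2; apply: contraNneq up2 => e.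
have [l1u l2u] : (l1 `&` l2) u by rewrite lu.
have a0 : p1 - u != 0 by rewrite subr_eq0 eq_sym.
(* A zero determinant puts [p2] on the line through [u] and [p1], which is [l1]; being on [l2] as
   well, [p2] would equal [u]. *)
have [t pt] : exists t : R, p2 - u = t *: (p1 - u).
  apply: (orthogonal_parallel _ e (dot_perpxx _) a0).
  apply: (@perp_neq0 _ _ (perp (p1 - u))).
  have <- : dot (p1 - u) (p1 - u) = dot (perp (p1 - u)) (perp (p1 - u)).
    by rewrite !dotE !mxE /=; ring.
  exact/lt0r_neq0/dot_gt0.
have : (l1 `&` l2) p2.
  split=> //; rewrite (is_line_through L1 l1u l1p up1).
  by exists t => //; rewrite -pt addrC subrK.
by rewrite lu => ->.
Qed.

(** Makes the two cases of the theorem exclusive: parameters 0 and 1 give distinct points of a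
    line. *)
Lemma line_setI_neq1 (R : realType) (l : set 'rV[R]_2) (u : 'rV[R]_2) :
  is_line l -> l `&` l <> [set u].
Proof.
rewrite setIid => -[a [d [d0 ->]]] e.
have in_u (t : R) : a + t *: d = u.
  by have : [set u] (a + t *: d) by rewrite -e; exists t.
have := in_u 1; rewrite -(in_u 0) => /addrI.
by rewrite scale1r scale0r => d0'; rewrite d0' eqxx in d0.
Qed.

(** * The search in each of the two cases *)

Lemma point_search_halfplane (R : realType) (p1 p2 pf : 'rV[R]_2)
    (l C : set 'rV[R]_2) :
  p1 != p2 -> is_line l -> closed_halfplane (line_through p1 p2) C ->
  point_search p1 p2 l l C pf <-> pf = midpoint p1 p2.
Proof.
move=> p12 L [n [c [n0 lE CE]]].
have on_l x : line_through p1 p2 x -> dot n x = c by rewrite lE.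
have mc := on_l _ (line_through_midpoint p1 p2).
have p1c := on_l _ (line_through_l p1 p2).
have p2c := on_l _ (line_through_r p1 p2).
have nw : dot n (p2 - p1) = 0 by rewrite dotBr p1c p2c subrr.
have w0 : p2 - p1 != 0 by rewrite subr_eq0 eq_sym.
have stop d q : d != 0 -> 0 < dot n d ->
    crossing C (midpoint p1 p2) d q <-> q = midpoint p1 p2.
  move=> d0 nd; rewrite (@crossingP _ _ _ _ _ 0) ?scale0r ?addr0 //.
  by move=> s s0; rewrite CE /= dotDZr mc gerDl pmulr_lle0.
split.
  case=> d [q [[d0 dw [H [[n' [c' [n'0 lE' HE]]] HC _ Hd]]] cq qm _]].
  have on_l' x : line_through p1 p2 x -> dot n' x = c' by rewrite lE'.
  have mc' := on_l' _ (line_through_midpoint p1 p2).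
  have n'w : dot n' (p2 - p1) = 0.
    rewrite dotBr !on_l' ?subrr //; first exact: line_through_l.
    exact: line_through_r.
  (* The normals of [C] and of [H] are both orthogonal to [p2 - p1], hence parallel. A factor
     [k >= 0] would put [H] inside [C], so the ray, which enters [H], points out of [C]. *)
  have [k nE] : exists k : R, n = k *: n'.
    apply: (@orthogonal_parallel _ (p2 - p1)) => //.
    - by rewrite -nw !dotE; ring.
    - by rewrite -n'w !dotE; ring.
  have n'd : dot n' d < 0.
    by have := Hd 1 ltr01; rewrite HE /= dotDZr mc' mul1r gtrDl.
  have cE : c = k * c' by rewrite -mc nE dotZl mc'.
  have k0 : k < 0.
    rewrite ltNge; apply/negP => k0; apply: (HC erefl) => x.
    by rewrite HE CE /= nE dotZl cE => /ltW h; rewrite ler_wpM2l.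
  by apply/qm/(stop _ _ d0 _).1 => //; rewrite nE dotZl nmulr_rgt0.
move=> ->; exists n, (midpoint p1 p2); split => //; last first.
  by apply/stop => //; exact: dot_gt0.
split=> //; exists [set x | dot (- n) x < - c]; split.
- exists (- n), (- c); split; rewrite ?oppr_eq0 // lE.
  by apply/seteqP; split => x /=; rewrite dotNl; [move=> ->|move/oppr_inj].
(* The point [p1 + n] lies in [H] but not in [C]. *)
- move=> _ /(_ (p1 + n)); rewrite CE /= dotNl dotDr p1c.
  have h := dot_gt0 n0.
  by rewrite ltrN2 ltrDl h => /(_ isT); rewrite gerDl leNgt h.
- by move=> u /(line_setI_neq1 L).
by move=> t t0; rewrite /= dotNl dotDZr mc ltrN2 ltrDl mulr_gt0 ?dot_gt0.
Qed.

Lemma point_search_cone (R : realType) (p1 p2 u pf : 'rV[R]_2)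
    (l1 l2 : set 'rV[R]_2) :
  p1 != p2 -> is_line l1 -> is_line l2 -> l1 p1 -> l2 p2 ->
  l1 `&` l2 = [set u] -> u != p1 -> u != p2 ->
  point_search p1 p2 l1 l2 (cone u p1 p2) pf <-> pf = u.
Proof.
move=> p12 L1 L2 l1p l2p lu up1 up2.
have D := noncollinear L1 L2 l1p l2p lu up1 up2.
have D' : dot (perp (p2 - u)) (p1 - u) != 0 by rewrite dot_perpC oppr_eq0.
have [l1u l2u] : (l1 `&` l2) u by rewrite lu.
have l12 : l1 <> l2.
  by move=> e; apply: (line_setI_neq1 (u := u) L1); rewrite {2}e.
have ray d : first_ray p1 p2 l1 l2 (cone u p1 p2) d ->
    exists s t : R, [/\ 0 <= s, 0 <= t, s + t < 1 &
      forall q, crossing (cone u p1 p2) (midpoint p1 p2) d q <->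
        q = u + s *: (p1 - u) + t *: (p2 - u)].
  case=> d0 _ [H [[n [c [n0 lE HE]]] _ /(_ u lu) Hu Hd]].
  have [al [be dE]] := basis_decomposition d D.
  apply: (crossing_cone_midpoint D dE).
  have on_l x : line_through p1 p2 x -> dot n x = c by rewrite lE.
  have mc := on_l _ (line_through_midpoint p1 p2).
  (* Since [n] is constant on the line, [p1 - u] and [p2 - u] have the same product with it,
     positive because [u] is in [H]. So [dot n d < 0] amounts to [al + be < 0]. *)
  have := Hd 1 ltr01; rewrite HE /= scale1r dotDr mc gtrDl.
  rewrite dE dotDr !dotZr !dotBr.
  rewrite (on_l _ (line_through_l p1 p2)) (on_l _ (line_through_r p1 p2)).
  move: Hu; rewrite HE /= => k0.
  by rewrite -mulrDl pmulr_llt0 // subr_gt0.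
have search d s t : 0 <= s -> 0 <= t -> s + t < 1 ->
    (forall q, crossing (cone u p1 p2) (midpoint p1 p2) d q <->
        q = u + s *: (p1 - u) + t *: (p2 - u)) ->
    forall q, crossing (cone u p1 p2) (midpoint p1 p2) d q ->
    q <> midpoint p1 p2 /\
    ((exists q1 q2 : 'rV[R]_2,
          [/\ crossing (cone u p1 p2) q (p1 - midpoint p1 p2) q1,
              crossing (cone u p1 p2) q (p2 - midpoint p1 p2) q2,
              p1 != q1,
              p2 != q2
            & line_through p1 q1 `&` line_through p2 q2 = [set pf]])
      <-> pf = u).
  move=> s0 t0 st1 cP q /cP qE.
  have c1 q1 := crossing_cone_parallel q1 D p12 s0 t0.
  have c2 q2 : crossing (cone u p1 p2) q (p2 - midpoint p1 p2) q2 <->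
      q2 = u + (s + t) *: (p2 - u).
    (* The second parallel ray is the first with [p1] and [p2] exchanged. *)
    rewrite qE coneC midpointC addrAC (addrC s).
    by apply: crossing_cone_parallel; rewrite // eq_sym.
  rewrite -qE in c1.
  (* The difference of the two points is [(1 - (s + t)) *: (p - u)], nonzero because [s + t < 1]. *)
  have neq p : u != p -> p != u + (s + t) *: (p - u).
    move=> up; apply/eqP => e; have /eqP : (1 - (s + t)) *: (p - u) = 0.
      rewrite scalerBl scale1r; apply/eqP; rewrite subr_eq0; apply/eqP.
      by rewrite {1}e addrAC subrr add0r.
    by rewrite scaler_eq0 !subr_eq0 gt_eqF // eq_sym (negPf up).
  have line l p : is_line l -> l p -> l u -> u != p ->
      line_through p (u + (s + t) *: (p - u)) = l.
    move=> L lp lu' up; apply/esym/is_line_through => //; last exact: neq.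
    by rewrite (is_line_through L lu' lp up); exists (s + t).
  split.
    (* The coordinates of the midpoint sum to 1, those of [q] to less. *)
    rewrite qE (_ : midpoint p1 p2 = u + 2^-1 *: (p1 - u) + 2^-1 *: (p2 - u)).
      by rewrite -!addrA => /addrI/(comb_inj D)[]; lra.
    by apply: row2P; rewrite !mxE; field.
  split.
    case=> q1 [q2 [/c1 -> /c2 -> _ _]].
    rewrite (line l1 p1) // (line l2 p2) // lu => e.
    by have : [set u] pf by rewrite e.
  move=> ->; exists (u + (s + t) *: (p1 - u)), (u + (s + t) *: (p2 - u)).
  by split; rewrite ?c1 ?c2 ?neq // (line l1 p1) // (line l2 p2).
split.
  case=> d [q [/ray[s [t [s0 t0 st cP]]] cq _ h]].
  have [qm [e _]] := search d s t s0 t0 st cP q cq.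
  exact/e/h.
move=> pfu.
(* Of the two normals to the line, take the one pointing towards [u]; [du] holds because that
   product equals the determinant in [D]. *)
have [d [n_w nu]] : exists d, dot d (p2 - p1) = 0 /\ 0 < dot d (u - p1).
  pose d := perp (p2 - p1).
  have dw : dot d (p2 - p1) = 0 by exact: dot_perpxx.
  have du : dot d (u - p1) != 0.
    by move: D; rewrite !dot_perp !mxE; congr (_ != 0); ring.
  case: (ltP 0 (dot d (u - p1))) => h; first by exists d.
  exists (- d); rewrite !dotNl dw oppr0; split=> //.
  by rewrite oppr_gt0 lt_neqAle du.
have d0 : d != 0.
  by apply: contraTneq nu => ->; rewrite dotE !mxE !mul0r addr0 ltxx.
have nd0 : - d != 0 by rewrite oppr_eq0.
have lE : line_through p1 p2 = [set x | dot (- d) x = dot (- d) p1].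
  by apply: line_throughE; rewrite // dotNl n_w oppr0.
have fr : first_ray p1 p2 l1 l2 (cone u p1 p2) d.
  (* The sign is flipped because [open_side] asks for a strict upper bound, while [u] is on the side
     where [dot d] is larger. *)
  split=> //; exists [set x | dot (- d) x < dot (- d) p1]; split => //.
  - by exists (- d), (dot (- d) p1).
  - move=> v; rewrite lu => /seteqP[_ /(_ v erefl) ->] /=.
    by rewrite -subr_lt0 -dotBr dotNl oppr_lt0.
  move=> t t0 /=; have := line_through_midpoint p1 p2; rewrite lE /= => mE.
  by rewrite dotDZr mE gtrDl dotNl mulrN oppr_lt0 mulr_gt0 ?dot_gt0.
have [s [t [s0 t0 st cP]]] := ray d fr.
have cq := (cP _).2 erefl.
have [qm [_ e]] := search d s t s0 t0 st cP _ cq.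
by exists d, (u + s *: (p1 - u) + t *: (p2 - u)); split => // _; apply: e.
Qed.

Theorem lemma1 (R : realType) (p1 p2 : 'rV[R]_2) (l1 l2 C : set 'rV[R]_2)
    (occ : 'rV[R]_2 -> bool) (lab : bool)
    (hp : p1 != p2)
    (hl1 : is_line l1) (hl2 : is_line l2)
    (hp1 : l1 p1) (hp2 : l2 p2)
    (hl : l1 = l2 \/
          exists u, [/\ l1 `&` l2 = [set u], u != p1 & u != p2])
    (hC : local_flatness p1 p2 l1 l2 C occ lab) :
  (exists! pf, point_search p1 p2 l1 l2 C pf) /\
  (forall pf, point_search p1 p2 l1 l2 C pf ->
     (l1 = l2 -> pf = midpoint p1 p2) /\
     (forall u, l1 `&` l2 = [set u] -> pf = u)).
Proof.
have [_ _ hA hB] := hC.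
(* Each case describes the output by an equivalence with one point, which gives existence and
   uniqueness together. *)
have unique v : (forall pf, point_search p1 p2 l1 l2 C pf <-> pf = v) ->
    exists! pf, point_search p1 p2 l1 l2 C pf.
  by move=> h; exists v; split => [|w /h ->]; first exact/h.
case: hl => [e|[u [lu up1 up2]]].
  have P pf : point_search p1 p2 l1 l2 C pf <-> pf = midpoint p1 p2.
    by rewrite -e; apply: point_search_halfplane; auto.
  split=> [|pf /P ->]; first exact: unique P.
  by split=> // u; rewrite -e => /(line_setI_neq1 hl1).
have P pf : point_search p1 p2 l1 l2 C pf <-> pf = u.
  by rewrite (hB u lu); apply: point_search_cone.
split=> [|pf /P ->]; first exact: unique P.
split=> [e|v]; last by rewrite lu => /seteqP[/(_ u erefl)].
by move: lu; rewrite -e => /(line_setI_neq1 hl1).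
Qed.
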